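(* Let $G$ be a totally minimal locally pseudocompact Hausdorff topological group. Then $G_0 = q(G)$ if and only if $G/G_0$ is zero-dimensional, in which case $G$ is strongly Vedenissoff.
   Context: All topological groups are assumed to be Hausdorff (hence Tychonoff), and are not necessarily abelian. A ''neighborhood'' of a point is an open set containing it. A Tychonoff space is zero-dimensional if it has a base consisting of clopen (open-and-closed) sets. A Tychonoff space $X$ is pseudocompact if every continuous real-valued map on $X$ is bounded. A topological group $G$ is locally pseudocompact if there is a neighborhood $U$ of the identity such that $\operatorname{cl}_G U$ is pseudocompact. A (Hausdorff) topological group $G$ is minimal if there is no strictly coarser Hausdorff group topology on $G$; $G$ is totally minimal if every Hausdorff quotient of $G$ is minimal (equivalently, every continuous surjective homomorphism from $G$ onto a Hausdorff group is open). For a topological group $G$: $G_0$ is the connected component of the identity; $q(G)$ is the quasi-component of the identity, i.e., the intersection of all clopen sets containing the identity; $z(G)$ is the intersection of all kernels of continuous homomorphisms from $G$ into zero-dimensional topological groups; $o(G)$ is the intersection of all open subgroups of $G$. $G$ is Vedenissoff if $G/G_0$ is zero-dimensional; it is strongly Vedenissoff if in addition $z(G)=o(G)$. *)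

(* Defs.v *)
From HB Require Import structures.
From mathcomp Require Import all_boot generic_quotient all_order all_algebra.
From mathcomp Require Import all_classical all_reals all_analysis.

Set Implicit Arguments.
Unset Strict Implicit.
Unset Printing Implicit Defensive.

Import numFieldNormedType.Exports.

Local Open Scope classical_set_scope.
Local Open Scope group_scope.

#[short(type="preTopologicalGroupType")]
HB.structure Definition PreTopologicalGroup :=
  {G of Topological G & Group G}.

Definition continuous_group_ops (G : preTopologicalGroupType) : Prop :=
  continuous (fun z : G * G => z.1 * z.2) /\ continuous (fun x : G => x^-1).

HB.mixin Record PreTopologicalGroup_isTopologicalGroup G
    & PreTopologicalGroup G := {
  group_ops_continuous : continuous_group_ops G }.

(* Hausdorffness is not part of the structure. *)
#[short(type="topologicalGroupType")]
HB.structure Definition TopologicalGroup :=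
  {G of PreTopologicalGroup G & PreTopologicalGroup_isTopologicalGroup G}.

Section TopologicalGroupTheory.
Context {G : topologicalGroupType}.

Lemma mulgr_continuous (g : G) : continuous (fun x : G => x * g).
Proof.
have [cM _] := @group_ops_continuous G.
move=> x W /(cM (x, g))[[A B] /= [Ax /nbhs_singleton Bg]] AB.
by apply: filterS Ax => a Aa; exact: (AB (a, g)).
Qed.

Lemma mulgl_continuous (g : G) : continuous (fun x : G => g * x).
Proof.
have [cM _] := @group_ops_continuous G.
move=> x W /(cM (g, x))[[A B] /= [/nbhs_singleton Ag Bx]] AB.
by apply: filterS Bx => b Bb; exact: (AB (g, b)).
Qed.

Lemma conjg_continuous (g : G) : continuous (fun x : G => x ^ g).
Proof.
move=> x; apply: (@continuous_comp G G G (fun x => x * g) (fun x => g^-1 * x)).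
  exact: mulgr_continuous.
exact: mulgl_continuous.
Qed.

End TopologicalGroupTheory.

Definition is_subgroup (G : groupType) (H : set G) : Prop :=
  [/\ H 1, (forall x y, H x -> H y -> H (x * y)) & forall x, H x -> H x^-1].

Record normal_subgroup (G : groupType) := NormalSubgroup {
  normal_set : set G;
  normal_is_subgroup : is_subgroup normal_set;
  normal_conj : forall x g, normal_set x -> normal_set (x ^ g) }.

Section CosetRelation.
Context {G : groupType} (N : normal_subgroup G).

Definition coset_rel : rel G := fun x y => `[< normal_set N (x^-1 * y) >].

Lemma coset_rel_equiv : equiv_class_of coset_rel.
Proof.
have [N1 NM NV] := normal_is_subgroup N; split.
- by move=> x; apply/asboolP; rewrite mulVg.
- have sym x y : coset_rel x y -> coset_rel y x.
    by move/asboolP/NV => Nyx; apply/asboolP; rewrite invgM invgK in Nyx.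
  by move=> x y; apply/idP/idP; exact: sym.
- move=> y x z /asboolP Nxy /asboolP Nyz; apply/asboolP.
  by have := NM _ _ Nxy Nyz; rewrite mulgA mulgK.
Qed.

Canonical coset_equiv := EquivRelPack coset_rel_equiv.

End CosetRelation.

(* The quotient group G/N with the quotient topology. *)
Definition quotient_group (G : topologicalGroupType) (N : normal_subgroup G) :
  Type := quotient_topology {eq_quot coset_equiv N}%qT.

Section QuotientGroup.
Local Open Scope quotient_scope.
Context {G : topologicalGroupType} (N : normal_subgroup G).
Local Notation Q := (quotient_group N).

HB.instance Definition _ := Topological.on Q.
HB.instance Definition _ := Quotient.on Q.

Let p : G -> Q := \pi_Q.

Lemma pi_quotient_groupP x y : p x = p y <-> normal_set N (x^-1 * y).
Proof.
rewrite /p; split.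
  by move/eqmodP => /asboolP.
by move=> Nxy; apply/eqmodP/asboolP.
Qed.

Let reprP (q : Q) : p (repr q) = q. Proof. exact: reprK. Qed.

Definition quotient_mul (q r : Q) : Q := \pi_Q (repr q * repr r).
Definition quotient_one : Q := \pi_Q 1.
Definition quotient_inv (q : Q) : Q := \pi_Q (repr q)^-1.

Lemma pi_quotient_mul x y : quotient_mul (p x) (p y) = p (x * y).
Proof.
have [N1 NM NV] := normal_is_subgroup N.
apply/pi_quotient_groupP.
have /pi_quotient_groupP Nx := reprP (p x).
have /pi_quotient_groupP Ny := reprP (p y).
rewrite invgM mulgA.
have := NM _ _ (normal_conj y Nx) (N1); rewrite mulg1 => Nxy.
have := NM _ _ Ny Nxy; rewrite /conjg !mulgA mulgK.
by [].
Qed.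

Lemma pi_quotient_inv x : quotient_inv (p x) = p x^-1.
Proof.
have [N1 NM NV] := normal_is_subgroup N.
apply/pi_quotient_groupP.
have /pi_quotient_groupP Nx := reprP (p x).
have := normal_conj x^-1 (NV _ Nx).
by rewrite /conjg invgM !invgK mulgA mulgA mulgV mul1g.
Qed.

Let pE (q : Q) : exists x, q = p x.
Proof. by exists (repr q); rewrite reprP. Qed.

Let quotient_mulA : associative quotient_mul.
Proof.
move=> q r s; have [[x ->] [y ->] [z ->]] := And3 (pE q) (pE r) (pE s).
by rewrite !pi_quotient_mul mulgA.
Qed.

Let quotient_mul1g : left_id quotient_one quotient_mul.
Proof. by move=> q; have [x ->] := pE q; rewrite pi_quotient_mul mul1g. Qed.

Let quotient_mulg1 : right_id quotient_one quotient_mul.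
Proof. by move=> q; have [x ->] := pE q; rewrite pi_quotient_mul mulg1. Qed.

Let quotient_mulVg : left_inverse quotient_one quotient_inv quotient_mul.
Proof.
move=> q; have [x ->] := pE q.
by rewrite pi_quotient_inv pi_quotient_mul mulVg.
Qed.

Let quotient_mulgV : right_inverse quotient_one quotient_inv quotient_mul.
Proof.
move=> q; have [x ->] := pE q.
by rewrite pi_quotient_inv pi_quotient_mul mulgV.
Qed.

HB.instance Definition _ := isGroup.Build Q quotient_mulA quotient_mul1g
  quotient_mulg1 quotient_mulVg quotient_mulgV.

Let pi_nbhs (x : G) (U : set G) : nbhs x U -> nbhs (p x) (p @` U).
Proof.
rewrite !nbhsE => -[V [oV Vx] VU]; exists (p @` V); last exact: image_subset.
split; last by exists x.

rewrite /open/= /quotient_open.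
have -> : \pi_Q @^-1` (p @` V) =
    \bigcup_(n in normal_set N) ((fun x => x * n^-1) @^-1` V).
  apply/seteqP; split => y /=.
    move=> [z Vz /pi_quotient_groupP Nzy]; exists (z^-1 * y) => //=.
    by rewrite invgM invgK mulgA mulgV mul1g.
  move=> [n Nn /= Vyn]; exists (y * n^-1) => //; apply/pi_quotient_groupP.
  by rewrite invgM invgK -mulgA mulVg mulg1.
apply: bigcup_open => n _; apply: open_comp => // y _.
exact: mulgr_continuous.
Qed.

Let quotient_continuous_ops : continuous_group_ops Q.
Proof.
have [cM cV] := @group_ops_continuous G; split.
  move=> [q r] W; have [[x ->] [y ->]] := conj (pE q) (pE r).
  rewrite /= [_ * _]pi_quotient_mul => /(pi_continuous).
  move=> /(cM (x, y))[[A B] /= [/pi_nbhs Ax /pi_nbhs By]] AB.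
  exists (p @` A, p @` B) => //= -[_ _] /= [[a Aa <-] [b Bb <-]].
  by rewrite [_ * _]pi_quotient_mul; exact: (AB (a, b)).
move=> q W; have [x ->] := pE q.
rewrite /= [_^-1]pi_quotient_inv => /(pi_continuous) /(cV x) /= /pi_nbhs.
apply: filterS => _ [y Wy <-].
by rewrite /= [_^-1]pi_quotient_inv.
Qed.

HB.instance Definition _ :=
  PreTopologicalGroup_isTopologicalGroup.Build Q quotient_continuous_ops.

End QuotientGroup.

Section IdentityComponent.
Context {G : topologicalGroupType}.

Definition identity_component : set G := connected_component [set: G] 1.

Local Notation G0 := identity_component.

Let image_sub (f : G -> G) : continuous f -> f 1 = 1 -> f @` G0 `<=` G0.
Proof.
move=> cf f1; apply: connected_component_max => //.
  by exists 1 => //; exact: connected_component_refl.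
apply: connected_continuous_connected; first exact: component_connected.
exact: continuous_subspaceT.
Qed.

Lemma identity_component_is_subgroup : is_subgroup G0.
Proof.
split; first exact: connected_component_refl.
- move=> x y G0x G0y; apply: (connected_component_trans G0x).
  apply: (@connected_component_max _ _ ((fun z => x * z) @` G0)) => //.
  + by exists 1; [exact: connected_component_refl | rewrite mulg1].
  + apply: connected_continuous_connected; first exact: component_connected.
    exact/continuous_subspaceT/mulgl_continuous.
  + by exists y.
- move=> x G0x; apply: (@image_sub (fun x => x^-1)); last by exists x.
    by have [] := @group_ops_continuous G.
  by rewrite invg1.
Qed.

Lemma identity_component_conj x g : G0 x -> G0 (x ^ g).
Proof.
move=> G0x; apply: (@image_sub (fun x => x ^ g)); last by exists x.
  exact: conjg_continuous.
by rewrite conj1g.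
Qed.

Definition identity_component_normal : normal_subgroup G :=
  NormalSubgroup identity_component_is_subgroup identity_component_conj.

End IdentityComponent.

Arguments identity_component G : clear implicits.
Arguments identity_component_normal G : clear implicits.

(* Topologies on a fixed group, given by their open sets; [retopologized tau] *)
(* is the group [G] carrying the topology [tau] instead of any other one.     *)
Record topology (T : Type) := Topology {
  topology_open : set (set T);
  topology_openT : topology_open setT;
  topology_openI : setI_closed topology_open;
  topology_bigcup : forall (I : Type) (f : I -> set T),
    (forall i, topology_open (f i)) -> topology_open (\bigcup_i f i) }.

Definition retopologized (G : groupType) (tau : topology G) : Type := G.

Section Retopologized.
Context {G : groupType} (tau : topology G).

HB.instance Definition _ := Group.copy (retopologized tau) G.
HB.instance Definition _ := @isOpenTopological.Build (retopologized tau)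
  (topology_open tau) (topology_openT tau) (@topology_openI _ tau)
  (@topology_bigcup _ tau).

End Retopologized.

Definition minimal_group (G : topologicalGroupType) : Prop :=
  hausdorff_space G /\
  ~ exists tau : topology G,
      [/\ continuous_group_ops (retopologized tau),
          hausdorff_space (retopologized tau) &
          topology_open tau `<` @open G].

Definition totally_minimal_group (G : topologicalGroupType) : Prop :=
  forall N : normal_subgroup G,
    hausdorff_space (quotient_group N) -> minimal_group (quotient_group N).

Definition tychonoff_space (T : topologicalType) : Prop :=
  hausdorff_space T /\ completely_regular_space T.

(* The library's [zero_dimensional] only asks clopen sets to separate points. *)
Definition zero_dimensional_space (T : topologicalType) : Prop :=
  tychonoff_space T /\ exists2 B : set (set T), basis B & B `<=` clopen.

(* [A] is regarded as a subspace of [T]; it is automatically Tychonoff when   *)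
(* [T] is a Hausdorff topological group.                                      *)
Definition pseudocompact (R : realType) (T : topologicalType) (A : set T) :
    Prop :=
  forall f : T -> R, {within A, continuous f} -> [bounded f x | x in A].

Definition locally_pseudocompact (R : realType) (G : topologicalGroupType) :
    Prop :=
  exists2 U : set G, open_nbhs 1 U & pseudocompact R (closure U).

Definition quasi_component (G : topologicalGroupType) : set G :=
  \bigcap_(C in [set C : set G | clopen C /\ C 1]) C.

Definition open_subgroup_core (G : topologicalGroupType) : set G :=
  \bigcap_(H in [set H : set G | open H /\ is_subgroup H]) H.

Definition zero_dimensional_kernel (G : topologicalGroupType) : set G :=
  [set x | forall (H : topologicalGroupType) (f : {multiplicative G -> H}),
    zero_dimensional_space H -> continuous f -> f x = 1].

Arguments quasi_component G : clear implicits.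
Arguments open_subgroup_core G : clear implicits.
Arguments zero_dimensional_kernel G : clear implicits.

Definition vedenissoff (G : topologicalGroupType) : Prop :=
  zero_dimensional_space (quotient_group (identity_component_normal G)).

Definition strongly_vedenissoff (G : topologicalGroupType) : Prop :=
  vedenissoff G /\ zero_dimensional_kernel G = open_subgroup_core G.

(* Main.v *)
Require Import Defs.
From HB Require Import structures.
From mathcomp Require Import all_boot generic_quotient all_order all_algebra.
From mathcomp Require Import all_classical all_reals all_analysis.
From mathcomp Require Import zify.

(** The heart of the matter is the following fact about a locally pseudocompact
group G: every clopen set containing 1 contains an open subgroup
([clopen_open_subgroup]).  It makes the quasi-component q(G) equal to the
intersection o(G) of all open subgroups, since open subgroups are clopen.

Granting this, suppose G_0 = q(G) = o(G).  The open subgroups of Q = G/o(G)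
form a base at 1 of a group topology on Q, which is Hausdorff because they
intersect in 1, coarser than the quotient topology, and has a base of clopen
sets, namely the cosets.  As G is totally minimal, Q is minimal, so this
topology is the quotient topology and Q is zero-dimensional
([minimal_zero_dimensional]).  Conversely, any zero-dimensional group topology
on G/G_0 separates its points by clopen sets, whence q(G) is contained in G_0;
the other inclusion always holds.  Finally q(G) is contained in z(G) for every
G, and z(G) is contained in the kernel o(G) of G -> Q when Q is
zero-dimensional, so z(G) = o(G).

The open subgroup is found without completing G.  Pseudocompactness is used
only through cluster points: a sequence of nonempty open subsets of a fixed
neighborhood U of 1 has a point all of whose neighborhoods meet infinitely many
of them ([feebly_compact]; it follows from pseudocompactness by summing bump
functions, as topological groups are completely regular).  This gives three
uniformity statements: U is covered by finitely many translates of any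
neighborhood of 1, conjugation by elements of U is equicontinuous at 1, and a
clopen set C is uniformly clopen on U ([clopen_uniform]), i.e. there is a
neighborhood V of 1 such that x and xv are on the same side of C for all x in U
and v in V.  One can then choose a sequence V_0 = U, V_1, V_2, ... which is a
base at 1 of a pseudometrizable group topology on the subgroup H generated by U
such that C remains clopen on H.  Cluster points make U relatively compact for
this topology, and van Dantzig's argument applies modulo the quasi-component q
of (H, V): the points reached from 1 inside U by chains of steps in q V_n lie,
for n large, in C and in q V_1.  Chains can therefore be translated by q so as
never to come near the boundary of U, so that the open subgroup generated by
V_n is contained in C ([V_clopen_open_subgroup]). *)

Set Implicit Arguments.
Unset Strict Implicit.
Unset Printing Implicit Defensive.

Import Order.TTheory GRing.Theory Num.Theory.
Import numFieldNormedType.Exports.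

Local Open Scope classical_set_scope.
Local Open Scope group_scope.

(** Rewriting with these rules brings a word in group elements to its reduced
form, bracketed to the left. *)
Local Notation groupE := (conjgE, invgM, invgK, mulgA, mulgK, mulgVK, mulgV,
  mulVg, mul1g, mulg1, invg1).

(** * Neighborhoods of the identity *)

Section GroupNeighborhoods.
Context {G : topologicalGroupType}.
Implicit Types (x g : G) (U V W A : set G).

Lemma nbhs_mulgl x g A : nbhs (g * x) A -> nbhs x [set y | A (g * y)].
Proof. exact: (@mulgl_continuous G g x). Qed.

Lemma nbhs_mulgr x g A : nbhs (x * g) A -> nbhs x [set y | A (y * g)].
Proof. exact: (@mulgr_continuous G g x). Qed.

Lemma nbhs1P x A : nbhs x A <-> nbhs 1 [set y | A (x * y)].
Proof.
split=> [xA|]; first by apply: nbhs_mulgl; rewrite mulg1.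
rewrite -{1}(mulVg x) => /nbhs_mulgl /=.
by apply: filterS => y; rewrite /= mulVKg.
Qed.

Lemma nbhs_ltranslate x V : nbhs 1 V -> nbhs x [set y | V (x^-1 * y)].
Proof. by move=> V1; apply/nbhs1P; apply: filterS V1 => y; rewrite /= mulKg. Qed.

Lemma nbhs_rtranslate x V : nbhs 1 V -> nbhs x [set y | V (y * x^-1)].
Proof. by move=> V1; apply: nbhs_mulgr; rewrite mulgV. Qed.

Lemma open_mulgl g A : open A -> open [set y | A (g * y)].
Proof. by apply: open_comp => ? _; exact: mulgl_continuous. Qed.

Lemma open_mulgr g A : open A -> open [set y | A (y * g)].
Proof. by apply: open_comp => ? _; exact: mulgr_continuous. Qed.

Lemma clopen_mulgl g A : clopen A -> clopen [set y | A (g * y)].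
Proof. by move=> /(preimage_clopen)/(_ (@mulgl_continuous G g)). Qed.

Definition symmetric_open_nbhs1 V :=
  [/\ open V, V 1 & forall x, V x -> V x^-1].

Lemma symmetric_open_nbhs1_nbhs V : symmetric_open_nbhs1 V -> nbhs 1 V.
Proof. by move=> [oV V1 _]; apply: open_nbhs_nbhs. Qed.

Lemma symmetric_nbhs1_split W : nbhs 1 W ->
  exists2 V, symmetric_open_nbhs1 V & forall x y, V x -> V y -> W (x * y).
Proof.
have [cM cV] := @group_ops_continuous G => W1.
have : nbhs ((fun z : G * G => z.1 * z.2) (1, 1)) W by rewrite /= mulg1.
move=> /(cM (1, 1))[[A B] /= [A1 B1] AB].
have : nbhs (1 : G) (A `&` B) by exact: filterI.
rewrite nbhsE => -[Q [oQ Q1] QAB].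
exists (Q `&` [set x | Q x^-1]).
  split=> [||x [Qx QVx]]; last by split=> //=; rewrite invgK.
    by apply: openI => //; apply: open_comp oQ => x _; exact: cV.
  by split=> //=; rewrite invg1.
move=> x y [/QAB[Ax _] _] [/QAB[_ By] _].
exact: (AB (x, y)).
Qed.

Lemma symmetric_nbhs1_sub W : nbhs 1 W ->
  exists2 V, symmetric_open_nbhs1 V & V `<=` W.
Proof.
move=> /symmetric_nbhs1_split[V sV VW]; exists V => // x Vx.
by rewrite -(mulg1 x); apply: VW => //; case: sV.
Qed.

Lemma nbhs_conjg g W : nbhs 1 W -> nbhs 1 [set x | W (x ^ g)].
Proof. by move=> W1; apply: (@conjg_continuous G g 1); rewrite conj1g. Qed.

Lemma open_nbhs_witness A : (forall x, A x -> nbhs x A) -> open A.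
Proof. by move=> nA; rewrite openE. Qed.

Lemma nbhs1_subgroup_open (H : set G) : is_subgroup H -> nbhs 1 H -> open H.
Proof.
move=> [_ HM _] H1; apply: open_nbhs_witness => x Hx.
apply/nbhs1P; apply: filterS H1 => y Hy; exact: HM.
Qed.

(** The complement of an open subgroup is a union of cosets. *)
Lemma open_subgroup_clopen (H : set G) : open H -> is_subgroup H -> clopen H.
Proof.
move=> oH [H1 HM HV]; split=> //; rewrite -openC.
apply: open_nbhs_witness => x nHx; apply/nbhs1P.
have : nbhs 1 H by exact: open_nbhs_nbhs.
apply: filterS => y Hy /= Hxy; apply: nHx.
by rewrite -(mulgK y x); apply: HM => //; exact: HV.
Qed.

Lemma conj_is_subgroup (H : set G) g :
  is_subgroup H -> is_subgroup [set x | H (x ^ g)].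
Proof.
move=> [H1 HM HV]; split=> /=; first by rewrite conj1g.
- by move=> x y Hx Hy; rewrite conjMg; exact: HM.
- by move=> x Hx; rewrite conjVg; exact: HV.
Qed.

End GroupNeighborhoods.

(** * Topological groups are completely regular *)

(** An alias of G that carries the left uniformity; its topology is that of G. *)
Definition left_uniform (G : topologicalGroupType) : Type := G.

Section LeftUniformity.
Local Open Scope relation_scope.
Context {G : topologicalGroupType}.

Definition left_entourage : set_system (G * G) :=
  [set E | nbhs 1 [set v : G | forall x, E (x, x * v)]].

Let left_filter : Filter left_entourage.
Proof.
split; first by apply: (@filterE _ (nbhs 1)).
- move=> E F; rewrite /left_entourage /= => E1 F1.
  by apply: (@filterS _ (nbhs 1) _ _ _ _ (filterI E1 F1)) => v [Ev Fv] x; split.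
- by move=> E F EF; apply: (@filterS _ (nbhs 1)) => v Ev x; apply/EF/Ev.
Qed.

Let left_diagonal A : left_entourage A -> diagonal `<=` A.
Proof.
move=> /nbhs_singleton A1 [x y] xy; have <- : x = y := xy.
by have := A1 x; rewrite mulg1.
Qed.

Let left_inv A : left_entourage A -> left_entourage A^-1.
Proof.
move=> /symmetric_nbhs1_sub[V [oV V1 VV] VA].
have : nbhs 1 V by exact: open_nbhs_nbhs.
apply: filterS => v /VV /VA /= Av x.
by have := Av (x * v); rewrite mulgK.
Qed.

Let left_split A : left_entourage A ->
  exists2 B, left_entourage B & B \; B `<=` A.
Proof.
move=> /symmetric_nbhs1_split[V sV VA].
exists [set p | V (p.1^-1 * p.2)].
  rewrite /left_entourage /=.
  by apply: filterS (symmetric_open_nbhs1_nbhs sV) => v Vv x /=; rewrite mulKg.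
move=> [x z] /= [y /= Vxy Vyz].
by have := VA _ _ Vxy Vyz x; rewrite mulgA !mulVKg.
Qed.

HB.instance Definition _ := Choice.on (left_uniform G).
HB.instance Definition _ :=
  isUniform.Build (left_uniform G) left_filter left_diagonal left_inv left_split.

End LeftUniformity.

Lemma topological_group_completely_regular (G : topologicalGroupType) :
  completely_regular_space G.
Proof.
move=> a B clB nBa.
have nB : nbhs a (~` B) by apply: open_nbhs_nbhs; split=> //; exact: closed_openC.
(* The pairs (x, y) with x different from a are kept, so that the entourage only
   has to be checked at x = a. *)
exists (Uniform.class (left_uniform G)),
  [set p | ~ B (p.1 * (p.1^-1 * p.2)) \/ p.1 <> a].
split.
- apply: filterS (iffLR (nbhs1P _ _) nB) => v /= nBv x.
  by have [->|?] := pselect (x = a); [left; rewrite mulKg|right].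
- by rewrite -subset0 => -[x y] /= [[-> By]]; rewrite mulVKg; case.
- move=> x A [E eE EA]; apply/nbhs1P.
  apply: (@filterS _ (nbhs (1 : G)) _ _ _ _ (eE : left_entourage E)) => v Ev.
  by apply: EA; apply/mem_set; exact: Ev.
Qed.

(** * Feeble compactness *)

(** When U is open this says that no infinite family of open subsets of U is
locally finite in T; the cluster point itself may lie outside U. *)
Definition feebly_compact (T : topologicalType) (U : set T) :=
  forall O : nat -> set T,
    (forall n, open (O n)) -> (forall n, O n !=set0) ->
    (forall n, O n `<=` U) ->
  exists z : T, forall W, nbhs z W ->
    forall m : nat, exists2 n, (m <= n)%N & (O n `&` W) !=set0.

Lemma feebly_compactS (T : topologicalType) (U V : set T) :
  V `<=` U -> feebly_compact U -> feebly_compact V.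
Proof.
move=> VU fcU O oO O0 OV; apply: fcU => // n; exact: subset_trans VU.
Qed.

Section LocallyFiniteSum.
Local Open Scope ring_scope.
Context {R : realType} {T : topologicalType}.
Variables (O : nat -> set T) (f : nat -> T -> R).
Hypothesis O_finite :
  forall z : T, exists2 W, nbhs z W & exists m : nat, forall n,
    (m <= n)%N -> O n `&` W = set0.
Hypothesis f_cont : forall n, continuous (f n).
Hypothesis f_supp : forall n x, ~ O n x -> f n x = 0.

(** Near each point the sum is a fixed finite sum, hence it is continuous. *)
Lemma locally_finite_sum : exists2 g : T -> R, continuous g &
  forall x, exists m : nat, forall k, (m <= k)%N -> g x = \sum_(n < k) f n x.
Proof.
have /choice[W] : forall z : T, exists W, nbhs z W /\ exists m : nat, forall n,
    (m <= n)%N -> O n `&` W = set0.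
  by move=> z; have [W zW Wm] := O_finite z; exists W.
move=> /all_and2[zW /choice[m mP]].
have sumE z k x : (m z <= k)%N -> W z x ->
    \sum_(n < k) f n x = \sum_(n < m z) f n x.
  move=> mk Wx; rewrite -!(big_mkord xpredT (f^~ x)) (big_cat_nat _ mk) //=.
  rewrite [X in _ + X]big_nat_cond [X in _ + X]big1 ?addr0 // => n.
  rewrite andbT => /andP[mn _]; apply: f_supp => On.
  by have /seteqP[/(_ x)+ _] := mP z n mn; apply.
exists (fun x => \sum_(n < m x) f n x).
  move=> z; have zz := nbhs_singleton (zW z).
  have : continuous (fun x => \sum_(n < m z) f n x).
    by apply: continuous_big; [exact: add_continuous | move=> n _; exact: f_cont].
  move=> /(_ z); apply: cvg_trans; apply: near_eq_cvg.
  near=> x.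
  have Wzx : W z x by near: x; exact: zW.
  have xx := nbhs_singleton (zW x).
  have [mm|/ltnW mm] := leqP (m z) (m x); first by rewrite (sumE z).
  by rewrite (sumE x).
move=> x; exists (m x) => k mk; rewrite (sumE x) //.
exact: nbhs_singleton (zW x).
Unshelve. all: by end_near. Qed.

End LocallyFiniteSum.

(** If the open sets O n were locally finite, then the sum of bump functions of
height n supported in O n would be continuous and unbounded on U. *)
Lemma pseudocompact_feebly_compact (R : realType) (T : topologicalType)
    (U : set T) : completely_regular_space T ->
  pseudocompact R (closure U) -> feebly_compact U.
Proof.
move=> crT pcU O oO O0 OU; apply: contrapT => noz.
have Ofin (z : T) : exists2 W, nbhs z W & exists m : nat, forall n,
    (m <= n)%N -> O n `&` W = set0.
  apply: contrapT => nW; apply: noz; exists z => W zW m.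
  apply: contrapT => nn; apply: nW; exists W => //; exists m => n mn.
  apply: contrapT => /eqP/set0P On0; apply: nn; by exists n.
have /choice[x Ox] : forall n, exists x, O n x by move=> n; exact: O0.
have /choice[f] : forall n, exists f : T -> R,
    [/\ continuous f, forall y, (0 <= f y)%R, f (x n) = n%:R%R
      & forall y, ~ O n y -> f y = 0%R].
  move=> n.
  have : ~ (~` O n) (x n) by apply.
  have clO : closed (~` O n) by exact: open_closedC.
  move=> /(crT _ _ clO) /(@uniform_separatorP _ R)[f [cf f01 f0 f1]].
  exists (fun y => n%:R * (1 - f y))%R; split.
  - move=> y; apply: cvgM; first exact: cvg_cst.
    by apply: cvgB; [exact: cvg_cst|exact: cf].
  - move=> y; apply: mulr_ge0 => //; rewrite subr_ge0.
    have /f01 : range f (f y) by exists y.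
    by rewrite /= in_itv /= => /andP[].
  - have -> : f (x n) = 0%R by apply: f0; exists (x n).
    by rewrite subr0 mulr1.
  - move=> y nOy; have -> : f y = 1%R by apply: f1; exists y.
    by rewrite subrr mulr0.
move=> /all_and4[cf f_ge0 fx fO].
have [g cg gE] := locally_finite_sum Ofin cf fO.
have := pcU g (continuous_subspaceT cg).
move=> [M [_ /(_ (M + 1)%R)]]; rewrite ltrDl ltr01 => /(_ isT) gM.
have [N MN] : exists N : nat, (M + 1 < N%:R)%R.
  exists (Num.bound `|M + 1|%R); apply: le_lt_trans (ler_norm _) _.
  exact: archi_boundP.
have xU : closure U (x N) by apply: subset_closure; exact: (OU N).
have := gM _ xU; apply/negP; rewrite -ltNge; apply: (lt_le_trans MN).
apply: le_trans (ler_norm _).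
have [k kE] := gE (x N).
rewrite (kE (maxn k N.+1)) ?leq_maxl // -(fx N).
have ltN : (N < maxn k N.+1)%N by rewrite leq_max ltnSn orbT.
rewrite (bigD1 (Ordinal ltN)) //= lerDl; apply: sumr_ge0 => i _; exact: f_ge0.
Qed.

(** * Relatively feebly compact open sets in a group *)

Section FeeblyCompactGroup.
Context {G : topologicalGroupType}.
Implicit Types (U V W A C : set G).

(** The form in which feeble compactness is used for a sequence of points: the
points need not cluster, but slight perturbations of them do. *)
Lemma feebly_compact_cluster U (x : nat -> G) (W : nat -> set G) :
  open U -> feebly_compact U -> (forall n, U (x n)) ->
  (forall n, symmetric_open_nbhs1 (W n)) ->
  exists z : G, forall A, nbhs z A ->
    forall m : nat, exists2 n, (m <= n)%N &
      exists2 w, W n w & (U `&` A) (x n * w).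
Proof.
move=> oU fcU Ux sW.
pose O n := U `&` [set y | W n ((x n)^-1 * y)].
have oO n : open (O n).
  by apply: openI => //; apply: open_mulgl; case: (sW n).
have O0 n : O n !=set0.
  by exists (x n); split=> //=; rewrite mulVg; case: (sW n).
have OU n : O n `<=` U by move=> ? [].
have [z zP] := fcU _ oO O0 OU; exists z => A zA m.
have [n mn [y [[Uy Wy] Ay]]] := zP _ zA m.
by exists n => //; exists ((x n)^-1 * y) => //; rewrite mulVKg.
Qed.

(** Otherwise some sequence in U is uniformly separated, and small translates
around its points are locally finite. *)
Lemma feebly_compact_precompact U V : open U -> feebly_compact U ->
  nbhs 1 V -> exists s : seq G, forall x, U x -> exists2 a, a \in s & V (a^-1 * x).
Proof.
move=> oU fcU V1; apply: contrapT => noS.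
have /choice[g] : forall s : seq G, exists x, U x /\
    forall a, a \in s -> ~ V (a^-1 * x).
  move=> s; apply: contrapT => nx; apply: noS; exists s => x Ux.
  apply: contrapT => na; apply: nx; exists x; split=> // a sa Va.
  by apply: na; exists a.
move=> /all_and2[Ug gV].
have [V2 sV2 V2V] := symmetric_nbhs1_split V1.
have [W sW WV2] := symmetric_nbhs1_split (symmetric_open_nbhs1_nbhs sV2).
have [oW W1 WV] := sW.
pose s n := iter n (fun s => g s :: s) [::].
have smem m n : (m < n)%N -> g (s m) \in s n.
  elim: n => // n IH; rewrite ltnS leq_eqVlt => /orP[/eqP->|/IH] /=.
    exact: mem_head.
  by rewrite inE => ->; rewrite orbT.
have [z zP] := feebly_compact_cluster oU fcU (fun n => Ug (s n)) (fun=> sW).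
have zW := nbhs_ltranslate z (symmetric_open_nbhs1_nbhs sW).
have [i _ [v Wv [_ /= Wzv]]] := zP _ zW 0%N.
have [j ij [w Ww [_ /= Wzw]]] := zP _ zW i.+1.
apply: (gV (s j) (g (s i))); first exact: smem.
have -> : (g (s i))^-1 * g (s j) =
    (v * (z^-1 * (g (s i) * v))^-1) * ((z^-1 * (g (s j) * w)) * w^-1).
  by rewrite !groupE.
by apply: V2V; apply: WV2 => //; exact: WV.
Qed.

(** Conjugation is continuous at 1 for each of the finitely many centers of a
cover of U by small translates, and x differs little from a center. *)
Lemma feebly_compact_conj U V : open U -> feebly_compact U -> nbhs 1 V ->
  exists2 W, nbhs 1 W & forall x w, U x -> W w -> V (w ^ x).
Proof.
move=> oU fcU V1.
have [V2 sV2 V2V] := symmetric_nbhs1_split V1.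
have [V4 sV4 V4V2] := symmetric_nbhs1_split (symmetric_open_nbhs1_nbhs sV2).
have [_ V41 V4V] := sV4.
have V4sub x : V4 x -> V2 x by rewrite -{2}[x]mulg1 => V4x; exact: V4V2.
have [s sP] := feebly_compact_precompact oU fcU (symmetric_open_nbhs1_nbhs sV4).
exists [set w | forall a, a \in s -> V4 (w ^ a)]; last first.
  move=> x w /sP[a sa V4a] /(_ a sa) V4w.
  have -> : w ^ x = (a^-1 * x)^-1 * (w ^ a) * (a^-1 * x).
    by rewrite !groupE.
  apply: V2V; last exact: V4sub.
  by apply: V4V2 => //; exact: V4V.
elim: s {sP} => [|a s IH]; first by apply: (@filterE _ (nbhs (1 : G))).
have Wa := nbhs_conjg a (symmetric_open_nbhs1_nbhs sV4).
apply: filterS (filterI Wa IH) => w [/= Va Vs] b.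
by rewrite inE => /orP[/eqP->//|/Vs].
Qed.

(** The sequences used in the proof of the Birkhoff-Kakutani metrization
theorem; their intersection is a subgroup. *)
Definition halving_nbhs (V : nat -> set G) :=
  (forall n, symmetric_open_nbhs1 (V n)) /\
  forall n x y, V n.+1 x -> V n.+1 y -> V n (x * y).

Section HalvingNbhs.
Variables (V : nat -> set G) (hV : halving_nbhs V).

Lemma halving_nbhs1 n : V n 1.
Proof. by case: (hV.1 n). Qed.

Lemma halving_nbhsV n x : V n x -> V n x^-1.
Proof. by case: (hV.1 n) => _ _; apply. Qed.

Lemma halving_nbhs_nbhs n : nbhs 1 (V n).
Proof. exact: symmetric_open_nbhs1_nbhs (hV.1 n). Qed.

Lemma halving_nbhsS m n x : (m <= n)%N -> V n x -> V m x.
Proof.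
elim: n => [|n IH]; first by rewrite leqn0 => /eqP->.
rewrite leq_eqVlt => /orP[/eqP->//|]; rewrite ltnS => mn Vx.
apply: IH => //; rewrite -(mulg1 x); apply: hV.2 => //; exact: halving_nbhs1.
Qed.

Lemma halving_nbhs3 n x y z :
  V n.+2 x -> V n.+2 y -> V n.+2 z -> V n (x * y * z).
Proof.
move=> Vx Vy Vz; apply: hV.2; first exact: hV.2.
exact: halving_nbhsS Vz.
Qed.

End HalvingNbhs.

(** At each step the next neighborhood may be constrained by the current one,
provided that all sufficiently small neighborhoods satisfy the constraint. *)
Lemma halving_nbhs_choice (Q : nat -> set G -> set G -> Prop) V0 :
  symmetric_open_nbhs1 V0 ->
  (forall n V, symmetric_open_nbhs1 V -> exists2 W, nbhs 1 W &
     forall W', symmetric_open_nbhs1 W' -> W' `<=` W -> Q n V W') ->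
  exists V : nat -> set G, [/\ V 0%N = V0, halving_nbhs V & forall n, Q n (V n) (V n.+1)].
Proof.
move=> sV0 stepQ.
have /choice[f fP] : forall p : nat * set G, exists W,
    symmetric_open_nbhs1 p.2 -> [/\ symmetric_open_nbhs1 W,
      forall x y, W x -> W y -> p.2 (x * y) & Q p.1 p.2 W].
  move=> [n V] /=; have [sV|nsV] := pselect (symmetric_open_nbhs1 V); last first.
    by exists V.
  have [A A1 AQ] := stepQ n V sV.
  have [B sB BV] := symmetric_nbhs1_split (symmetric_open_nbhs1_nbhs sV).
  have [W sW WAB] := symmetric_nbhs1_sub
    (filterI A1 (symmetric_open_nbhs1_nbhs sB)).
  exists W => _; split=> // [x y /WAB[_ Bx] /WAB[_ By]|]; first exact: BV.
  by apply: AQ => // x /WAB[].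
pose V := fix V n := if n is n'.+1 then f (n', V n') else V0.
have sV n : symmetric_open_nbhs1 (V n).
  by elim: n => //= n IH; case: (fP (n, V n) IH).
exists V; split=> // [|n]; last by case: (fP (n, V n) (sV n)).
by split=> // n x y; case: (fP (n, V n) (sV n)) => _ + _; apply.
Qed.

(** Suppose that for each neighborhood there are x in U and C and a small v with
xv outside C.  Choose such x_n, v_n together with a halving sequence V_n so
that v_n is in V_n, x_n V_(n+1) is contained in C and x_n v_n V_(n+1) misses C.
Let N be the intersection of the V_n.  Feeble compactness shows that each
neighborhood W of 1 satisfies V_m <= W N for some m.  The sets x_n V_(n+2)
cluster at a point z, which is in C since C is closed.  But x_n v_n is close to
z in the sense of the V_m, hence by the previous remark some element of
x_n v_n N, which is outside C, is close to z in the original topology.  This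
contradicts the openness of C. *)
Let clopen_half_uniform U C :
  open U -> U 1 -> feebly_compact U -> clopen C ->
  exists2 V, nbhs 1 V & forall x v, U x -> C x -> V v -> C (x * v).
Proof.
move=> oU U1 fcU [oC cC]; apply: contrapT => nV.
have nbhsC x : C x -> nbhs 1 [set w | C (x * w)].
  by move=> Cx; apply: (iffLR (nbhs1P x C)); exact: open_nbhs_nbhs.
have nbhsnC x : ~ C x -> nbhs 1 [set w | ~ C (x * w)].
  move=> nCx; apply: (iffLR (nbhs1P x (~` C))).
  by apply: open_nbhs_nbhs; split=> //; exact: closed_openC.
have U1n : nbhs 1 U by exact: open_nbhs_nbhs.
have [V0 sV0 V0U] := symmetric_nbhs1_sub U1n.
pose Q (V W : set G) (p : G * G) := [/\ U p.1, V p.2,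
  forall w, W w -> C (p.1 * w) & forall w, W w -> ~ C (p.1 * p.2 * w)].
have [|V [V0E hV /choice[p pP]]] := @halving_nbhs_choice
    (fun _ V W => exists p, Q V W p) V0 sV0.
  move=> _ V sV.
  have [[x v] [Ux Cx Vv nCxv]] : exists p : G * G,
      [/\ U p.1, C p.1, V p.2 & ~ C (p.1 * p.2)].
    apply: contrapT => np; apply: nV.
    exists V; first exact: symmetric_open_nbhs1_nbhs.
    move=> x v Ux Cx Vv; apply: contrapT => nC; apply: np.
    by exists (x, v).
  exists ([set w | C (x * w)] `&` [set w | ~ C (x * v * w)]).
    by apply: filterI; [exact: nbhsC|exact: nbhsnC].
  by move=> W _ WS; exists (x, v); split=> //= w /WS[].
pose x n := (p n).1; pose v n := (p n).2.
pose N := [set y | forall n, V n y].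
have VU n : V n `<=` U.
  by move=> y /(halving_nbhsS hV (leq0n n)); rewrite V0E; exact: V0U.
have VN W : nbhs 1 W ->
    exists m, forall y, V m y -> exists2 w, W w & N (w^-1 * y).
  move=> W1; apply: contrapT => nm.
  have /choice[y yP] : forall m, exists y, V m y /\
      forall w, W w -> ~ N (w^-1 * y).
    move=> m; apply: contrapT => ny; apply: nm; exists m => y Vy.
    apply: contrapT => nw; apply: ny; exists y; split=> // w Ww Nw.
    by apply: nw; exists w.
  have [Vy nNy] := all_and2 yP.
  have [B sB BW] := symmetric_nbhs1_split W1.
  have [oB B1 BV] := sB.
  pose O m := V m `&` [set u | B (u * (y m)^-1)].
  have oO m : open (O m).
    by apply: openI; [case: (hV.1 m)|exact: open_mulgr].
  have O0 m : O m !=set0 by exists (y m); split=> //=; rewrite mulgV.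
  have [|z zP] := fcU O oO O0; first by move=> m u [/VU].
  have Nz k : V k z.
    have zV := nbhs_ltranslate z (halving_nbhs_nbhs hV k.+1).
    have [n kn [u [[Vu _] Vzu]]] := zP _ zV k.+1.
    rewrite -(mulgVK (z^-1 * u)^-1 z); apply: hV.2; last first.
      exact: halving_nbhsV.
    by rewrite invgK mulVKg; exact: halving_nbhsS Vu.
  have [n _ [u [[_ Buy] /= Buz]]] := zP _ (nbhs_rtranslate z (symmetric_open_nbhs1_nbhs sB)) 0%N.
  apply: (nNy n (y n * z^-1)); last by rewrite !groupE.
  have -> : y n * z^-1 = (u * (y n)^-1)^-1 * (u * z^-1) by rewrite !groupE.
  by apply: BW => //; exact: BV.
have Ux n : U (x n) by case: (pP n).
have [z zP] := feebly_compact_cluster oU fcU Ux (fun n => hV.1 n.+2).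
have Cz : C z.
  apply: contrapT => nCz.
  have zC : nbhs z (~` C) by apply: open_nbhs_nbhs; split=> //; exact: closed_openC.
  have [n _ [w Vw [_ nCw]]] := zP _ zC 0%N.
  case: (pP n) => _ _ Cx _; apply: nCw; apply: Cx.
  exact: halving_nbhsS Vw.
have [m mP] := VN _ (nbhsC z Cz).
have zV := nbhs_ltranslate z (halving_nbhs_nbhs hV m.+2).
have [n mn [a Va [_ Vza]]] := zP _ zV m.+2.
have [w Cw Nw] : exists2 w, C (z * w) & N (w^-1 * (z^-1 * (x n * v n))).
  apply: mP.
  have -> : z^-1 * (x n * v n) = z^-1 * (x n * a) * a^-1 * v n.
    by rewrite !groupE.
  apply: halving_nbhs3 => //.
    by apply: halving_nbhsV => //; apply: (halving_nbhsS hV _ Va); lia.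
  by case: (pP n) => _ Vv _ _; exact: halving_nbhsS Vv.
case: (pP n) => _ _ _ /(_ (w^-1 * (z^-1 * (x n * v n)))^-1); apply.
  by apply: (halving_nbhsV hV); exact: Nw.
by rewrite -/(x n) -/(v n) !groupE.
Qed.

Lemma clopen_uniform U C : open U -> U 1 -> feebly_compact U -> clopen C ->
  exists2 V, nbhs 1 V & forall x v, U x -> V v -> C x <-> C (x * v).
Proof.
move=> oU U1 fcU clC.
have [V V1 VC] := clopen_half_uniform oU U1 fcU clC.
have [W W1 WC] := clopen_half_uniform oU U1 fcU (clopenC C clC).
exists (V `&` W); first exact: filterI.
move=> x v Ux [Vv Wv]; split=> [Cx|Cxv]; first exact: VC.
by apply: contrapT => /WC /(_ Wv); exact.
Qed.

End FeeblyCompactGroup.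

(** * The subgroup generated by a symmetric set *)

Section Generated.
Context {G : groupType}.
Implicit Types (A B : set G).

Fixpoint set_power A n : set G :=
  if n is m.+1 then [set x * y | x in set_power A m & y in A] else [set 1].

Definition generated A := \bigcup_n set_power A n.

Lemma set_powerD A m n x y :
  set_power A m x -> set_power A n y -> set_power A (m + n)%N (x * y).
Proof.
move=> Ax; elim: n y => [y ->|n IH _ [y Ay] [a Aa] <-].
  by rewrite addn0 mulg1.
by rewrite addnS mulgA; exists (x * y); [exact: IH|exists a].
Qed.

Lemma set_power1 A x : A x -> set_power A 1 x.
Proof. by move=> Ax; exists 1 => //; exists x => //; rewrite mul1g. Qed.

Lemma generated_sub A : A `<=` generated A.
Proof. by move=> x Ax; exists 1%N => //; exact: set_power1. Qed.

Lemma generated_min A B :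
  B 1 -> (forall x a, B x -> A a -> B (x * a)) -> generated A `<=` B.
Proof.
move=> B1 BA x [n _]; elim: n x => [_ ->//|n IH _ [y /IH By] [a Aa] <-].
exact: BA.
Qed.

Lemma generated_is_subgroup A :
  (forall x, A x -> A x^-1) -> is_subgroup (generated A).
Proof.
move=> AV; split; first by exists 0%N.
  move=> x y [m _ Ax] [n _ Ay]; exists (m + n)%N => //; exact: set_powerD.
move=> x [n _ Ax]; exists n => //; elim: n x Ax => [_ ->|n IH _ [y Ay] [a Aa] <-].
  by rewrite invg1.
rewrite invgM -[n.+1]add1n; apply: set_powerD; last exact: IH.
exact/set_power1/AV.
Qed.

End Generated.

(** * Clopen sets contain open subgroups *)

Section PowersOfFeeblyCompact.
Context {G : topologicalGroupType}.
Variables (U0 U : set G).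
Hypothesis (oU0 : open U0) (fcU0 : feebly_compact U0).
Hypothesis (sU : symmetric_open_nbhs1 U).
Hypothesis (UU0 : forall x y, U x -> U y -> U0 (x * y)).

Let U1 : U 1. Proof. by case: sU. Qed.

Let UsubU0 : U `<=` U0.
Proof. by move=> x Ux; rewrite -(mulg1 x); exact: UU0. Qed.

(** U U is covered by finitely many translates of U, and this propagates to all
powers of U. *)
Lemma set_power_precompact n : exists s : seq G, forall x,
  set_power U n x -> exists2 a, a \in s & U (a^-1 * x).
Proof.
have [t tP] := feebly_compact_precompact oU0 fcU0 (symmetric_open_nbhs1_nbhs sU).
elim: n => [|n [s sP]].
  exists [:: 1] => _ ->; exists 1; first by rewrite inE.
  by rewrite mulVg.
exists [seq a * b | a <- s, b <- t] => _ [y /sP[a sa Uay] [u Uu] <-].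
have /tP[b tb Ub] : U0 (a^-1 * y * u) by exact: UU0.
exists (a * b); first by apply/allpairsP; exists (a, b).
by rewrite invgM -mulgA [a^-1 * _]mulgA.
Qed.

(** On a translate aU, uniformity of C is uniformity of a^-1 C on U. *)
Lemma clopen_uniform_power (C : set G) n : clopen C ->
  exists2 V, nbhs 1 V &
    forall x v, set_power U n x -> V v -> C x <-> C (x * v).
Proof.
move=> clC; have [s sP] := set_power_precompact n.
have [V V1 VP] : exists2 V, nbhs 1 V & forall a x v,
    a \in s -> U (a^-1 * x) -> V v -> C x <-> C (x * v).
  elim: s {sP} => [|a s [V V1 VP]]; first by exists setT => //; exact: filterT.
  have oU : open U by case: sU.
  have [W W1 WP] := clopen_uniform oU U1 (feebly_compactS UsubU0 fcU0)
    (clopen_mulgl a clC).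
  exists (V `&` W); first exact: filterI.
  move=> b x v; rewrite inE => /orP[/eqP->|sb] Ux [Vv Wv]; last exact: VP Ux Vv.
  by have /= := WP _ _ Ux Wv; rewrite !mulgA !groupE.
exists V => // x v /sP[a sa Ua] Vv; exact: VP sa Ua Vv.
Qed.

End PowersOfFeeblyCompact.

(** The sets V n form a base at 1 of a group topology, not necessarily Hausdorff,
on the subgroup H generated by U; the hypothesis [V_conj] makes the base
invariant under conjugation by H.  This topology is coarser than the original
one, and [V_clopen] is clopenness for it. *)
Section OpenSubgroupInClopen.
Context {G : topologicalGroupType}.
Variables (U : set G) (V : nat -> set G).
Hypothesis fcU : feebly_compact U.
Hypothesis hV : halving_nbhs V.
Hypothesis V0 : V 0 = U.
Hypothesis V_conj : forall n x v, U x -> V n.+1 v -> V n (v ^ x).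

Local Notation H := (generated U).

Definition V_clopen (D : set G) :=
  forall x, H x -> exists n, forall v, V n v -> D x <-> D (x * v).

Definition V_quasi_component : set G :=
  [set x | H x /\ forall D, V_clopen D -> D 1 -> D x].

Local Notation q := V_quasi_component.

Let sU : symmetric_open_nbhs1 U.
Proof. by rewrite -V0; exact: hV.1. Qed.

Let oU : open U. Proof. by case: sU. Qed.

Let H_subgroup : is_subgroup H.
Proof. by apply: generated_is_subgroup; case: sU. Qed.

Let HM x y : H x -> H y -> H (x * y). Proof. by case: H_subgroup => _ + _; apply. Qed.
Let HV x : H x -> H x^-1. Proof. by case: H_subgroup => _ _; apply. Qed.
Let H1 : H 1. Proof. by case: H_subgroup. Qed.
Let UH x : U x -> H x. Proof. exact: generated_sub. Qed.

Let VU n : V n `<=` U.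
Proof. by move=> x /(halving_nbhsS hV (leq0n n)); rewrite V0. Qed.

Let VH n x : V n x -> H x. Proof. by move=> /VU/UH. Qed.

Let V_conj_power n k g v : set_power U k g -> V (n + k)%N v -> V n (v ^ g).
Proof.
elim: k n g v => [n _ v ->|k IH n _ v [y Uy] [u Uu] <-].
  by rewrite addn0 conjg1.
rewrite addnS -addSn conjgM => Vv; apply: V_conj => //; exact: IH Vv.
Qed.

Lemma V_clopenC D : V_clopen D -> V_clopen (~` D).
Proof.
move=> aD x /aD[n nP]; exists n => v /nP DD.
by split; apply: contra_not => /DD.
Qed.

(** Right translation by b costs a shift of the index by the length of b as a
word in U. *)
Lemma V_clopen_translate D a b : V_clopen D -> H a -> H b ->
  V_clopen [set y | D (a * y * b)].
Proof.
move=> aD Ha [k Uk Hb] x Hx /=.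
have [|n nP] := aD (a * x * b); first by apply: HM; [exact: HM|exists k].
exists (n + k)%N => v Vv.
have -> : a * (x * v) * b = a * x * b * v ^ b by rewrite !groupE.
by apply: nP; exact: V_conj_power Hb Vv.
Qed.

Lemma V_quasi_component1E s D : q s -> V_clopen D -> D 1 <-> D s.
Proof.
move=> [_ qs] aD; split=> [|Ds]; first exact: qs.
apply: contrapT => nD1; exact: (qs _ (V_clopenC aD) nD1).
Qed.

(** V-clopen sets are unions of cosets of q, because their translates are
V-clopen. *)
Lemma V_quasi_component_mulr s x D : q s -> H x -> V_clopen D ->
  D x <-> D (x * s).
Proof.
move=> qs Hx aD.
have := V_quasi_component1E qs (V_clopen_translate aD Hx H1).
by rewrite /= !mulg1.
Qed.

Lemma V_quasi_component_mull s x D : q s -> H x -> V_clopen D ->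
  D x <-> D (s * x).
Proof.
move=> qs Hx aD.
have := V_quasi_component1E qs (V_clopen_translate aD H1 Hx).
by rewrite /= !mul1g.
Qed.

Lemma V_quasi_component_is_subgroup : is_subgroup q.
Proof.
split.
- by split.
- move=> s t [Hs qs] [Ht qt]; split; first exact: HM.
  move=> D aD D1; apply/(V_quasi_component_mull (s := s) (conj Hs qs) Ht aD); exact: qt.
- move=> s qs; have [Hs _] := qs; split; first exact: HV.
  move=> D aD D1; apply/(V_quasi_component_mull qs (HV Hs) aD).
  by rewrite mulgV.
Qed.

Let qM x y : q x -> q y -> q (x * y).
Proof. by case: V_quasi_component_is_subgroup => _ + _; apply. Qed.
Let qV x : q x -> q x^-1.
Proof. by case: V_quasi_component_is_subgroup => _ _; apply. Qed.
Let q1 : q 1. Proof. by case: V_quasi_component_is_subgroup. Qed.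

Lemma V_quasi_component_conj s x : q s -> H x -> q (s ^ x).
Proof.
move=> [Hs qs] Hx; split; first by apply: HM; [exact: HV|exact: HM].
move=> D aD D1; rewrite conjgE mulgA.
by apply: (qs _ (V_clopen_translate aD (HV Hx) Hx)); rewrite /= mulg1 mulVg.
Qed.

(** U is contained in the subgroup H, which is closed because it is open. *)
Let cluster_in_H (x : nat -> G) (z : G) : (forall n, U (x n)) ->
  (forall A, nbhs z A ->
     forall m : nat, exists2 n, (m <= n)%N &
       exists2 w, V n w & (U `&` A) (x n * w)) ->
  H z.
Proof.
move=> Ux zP.
have [n _ [w' Vw [_ /VH Hzw]]] := zP _ (nbhs_ltranslate z (halving_nbhs_nbhs hV 0)) 0%N.
rewrite -(mulgVK (z^-1 * (x n * w'))^-1 z); apply: HM; last exact: HV.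
rewrite invgK mulVKg; apply: HM; [exact: UH|exact: VH Vw].
Qed.

(** U is relatively compact for the topology of the V n: points of U where D
fails to be uniform would accumulate at a point of H where D is not V-clopen. *)
Lemma V_clopen_uniform D : V_clopen D ->
  exists n, forall x v, U x -> V n v -> D x <-> D (x * v).
Proof.
move=> aD; apply: contrapT => nn.
have /choice[p pP] : forall n, exists p : G * G,
    [/\ U p.1, V n p.2 & ~ (D p.1 <-> D (p.1 * p.2))].
  move=> n; apply: contrapT => np; apply: nn; exists n => x v Ux Vv.
  by apply: contrapT => nD; apply: np; exists (x, v).
have Ux n : U (p n).1 by case: (pP n).
have [z zP] := feebly_compact_cluster oU fcU Ux hV.1.
have Hz : H z by exact: (cluster_in_H Ux zP).
have [m mP] := aD z Hz.
have [n mn [a Va [_ Vza]]] := zP _ (nbhs_ltranslate z (halving_nbhs_nbhs hV m.+2)) m.+2.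
case: (pP n) => _ Vv; apply.
have Va' := halving_nbhsV hV (halving_nbhsS hV mn Va).
have Vv' := halving_nbhsS hV mn Vv.
have /mP : V m (z^-1 * (p n).1).
  have -> : z^-1 * (p n).1 = z^-1 * ((p n).1 * a) * a^-1 * 1 by rewrite !groupE.
  by apply: halving_nbhs3 => //; exact: halving_nbhs1.
have /mP : V m (z^-1 * ((p n).1 * (p n).2)).
  have -> : z^-1 * ((p n).1 * (p n).2) =
    z^-1 * ((p n).1 * a) * a^-1 * (p n).2 by rewrite !groupE.
  exact: halving_nbhs3.
rewrite !mulVKg => E1 E2; by split=> [/E2/E1|/E1/E2].
Qed.

(** The chains are those of the quotient by q, kept inside U by the choice of
representatives. *)
Inductive q_chain n : G -> Prop :=
| q_chain1 : q_chain n 1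
| q_chainS x s v : q_chain n x -> q s -> V n v -> U (x * s * v) ->
    q_chain n (x * s * v).

Lemma q_chain_sub n : q_chain n `<=` U.
Proof. by move=> _ [|//]; case: sU. Qed.

Lemma q_chain_le m n : (m <= n)%N -> q_chain n `<=` q_chain m.
Proof.
move=> mn x; elim=> [|{}x s v _ IH qs Vv Uxsv]; first exact: q_chain1.
by apply: q_chainS => //; exact: halving_nbhsS Vv.
Qed.

Lemma q_chain_V_clopen D : V_clopen D -> D 1 ->
  exists n, q_chain n `<=` D.
Proof.
move=> aD D1; have [n nP] := V_clopen_uniform aD; exists n => x.
elim=> [//|{}x s v cx Dx qs Vv _].
have Ux := q_chain_sub cx.
have -> : x * s * v = x * v * s ^ v by rewrite !groupE.
have Hxv : H (x * v) by apply: HM; [exact: UH|exact: VH Vv].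
apply/(V_quasi_component_mulr (V_quasi_component_conj qs (VH Vv)) Hxv aD).
exact/(nP _ _ Ux Vv).
Qed.

(** Points of [q_chain n], for n tending to infinity, only accumulate at points
which belong to every V-clopen set containing 1, that is, in q. *)
Lemma q_chain_small k : exists n, forall x, q_chain n x ->
  exists2 s, q s & V k (s^-1 * x).
Proof.
apply: contrapT => nn.
have /choice[p] : forall n, exists x, q_chain n x /\
    forall s, q s -> ~ V k (s^-1 * x).
  move=> n; apply: contrapT => nx; apply: nn; exists n => x cx.
  apply: contrapT => ns; apply: nx; exists x; split=> // s qs Vs.
  by apply: ns; exists s.
move=> /all_and2[cp qp].
have Up n : U (p n) by exact: q_chain_sub (cp n).
have [z zP] := feebly_compact_cluster oU fcU Up hV.1.
have Hz : H z by exact: (cluster_in_H Up zP).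
have qz : q z.
  split=> // D aD D1; have [m mP] := aD z Hz.
  have [l lP] := q_chain_V_clopen aD D1.
  have [n ln [a Va [Upa Vza]]] :=
    zP _ (nbhs_ltranslate z (halving_nbhs_nbhs hV m)) l.
  apply/(mP _ Vza); rewrite mulVKg; apply: lP; apply: (q_chain_le ln).
  by rewrite -[p n]mulg1; apply: q_chainS => //; rewrite mulg1.
have [n kn [a Va [_ Vza]]] := zP _ (nbhs_ltranslate z (halving_nbhs_nbhs hV k.+1)) k.+1.
apply: (qp n z qz).
have -> : z^-1 * p n = z^-1 * (p n * a) * a^-1 by rewrite !groupE.
apply: hV.2 => //; apply: (halving_nbhsV hV); exact: (halving_nbhsS hV kn Va).
Qed.

(** The set B = q P is right invariant under V n, where P consists of the points
reached by chains: an element x of P is congruent modulo q to some w in V 1, so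
for v in V n the point wv, which is congruent to xv, lies in U and is reached
from x by a step of the chain. *)
Lemma V_clopen_open_subgroup C : V_clopen C -> C 1 ->
  exists K : set G, [/\ open K, is_subgroup K & K `<=` C].
Proof.
move=> aC C1.
have [n1 n1P] := q_chain_small 1.
have [n2 n2P] := q_chain_V_clopen aC C1.
pose n := maxn 1 (maxn n1 n2).
have n1n : (n1 <= n)%N by rewrite /n; lia.
have n2n : (n2 <= n)%N by rewrite /n; lia.
have n0n : (1 <= n)%N by rewrite /n; lia.
have VnV x : V n x -> V n x^-1 by exact: halving_nbhsV.
have K_subgroup := generated_is_subgroup VnV.
exists (generated (V n)); split=> //.
  apply: nbhs1_subgroup_open => //.
  apply: filterS (halving_nbhs_nbhs hV n); exact: generated_sub.
pose B := [set s * x | s in q & x in q_chain n].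
apply: (@subset_trans _ B).
  apply: generated_min => [|_ v [s qs [x cx <-]] Vv].
    by exists 1 => //; exists 1; [exact: q_chain1|rewrite mulg1].
  have [t qt Vtx] := n1P x (q_chain_le n1n cx).
  have Hx := UH (q_chain_sub cx).
  have qtx := V_quasi_component_conj (qV qt) Hx.
  exists (s * t); first exact: qM.
  exists (t^-1 * x * v); last by rewrite !groupE.
  have -> : t^-1 * x * v = x * (t^-1 ^ x) * v by rewrite !groupE.
  apply: q_chainS => //.
  have -> : x * (t^-1 ^ x) * v = t^-1 * x * v by rewrite !groupE.
  by rewrite -V0; apply: hV.2 => //; exact: (halving_nbhsS hV n0n Vv).
move=> _ [s qs [x cx <-]].
have Hx := UH (q_chain_sub cx).
apply/(V_quasi_component_mull qs Hx aC).
exact/n2P/(q_chain_le n2n cx).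
Qed.

End OpenSubgroupInClopen.

(** The sequence V is chosen so that C is uniform with index n + 1 on the n-th
power of U, which makes C clopen in the topology of the V n. *)
Theorem clopen_open_subgroup (G : topologicalGroupType) (U0 C : set G) :
  open_nbhs 1 U0 -> feebly_compact U0 -> clopen C -> C 1 ->
  exists K : set G, [/\ open K, is_subgroup K & K `<=` C].
Proof.
move=> oU0 fcU0 clC C1.
have [U sU UU0] := symmetric_nbhs1_split (open_nbhs_nbhs oU0).
have UsubU0 : U `<=` U0.
  by move=> x Ux; rewrite -(mulg1 x); apply: UU0 => //; case: sU.
have fcU := feebly_compactS UsubU0 fcU0.
have oU : open U by case: sU.
have [|V [V0 hV VQ]] := @halving_nbhs_choice G (fun n V W =>
    (forall x w, U x -> W w -> V (w ^ x)) /\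
    (forall x w, set_power U n x -> W w -> C x <-> C (x * w))) U sU.
  move=> n V sV.
  have [A A1 AV] := feebly_compact_conj oU fcU (symmetric_open_nbhs1_nbhs sV).
  have [B B1 BC] := clopen_uniform_power oU0.1 fcU0 sU UU0 n clC.
  exists (A `&` B); first exact: filterI.
  move=> W _ WAB; split=> x w Xx /WAB[Aw Bw]; first exact: AV.
  exact: BC.
apply: (V_clopen_open_subgroup fcU hV V0 _ _ C1).
  by move=> n x v Ux Vv; case: (VQ n) => + _; apply.
move=> x [n _ Ux]; exists n.+1 => v Vv; case: (VQ n) => _; apply => //.
Qed.

(** * The topology generated by the open subgroups *)

Section LinearTopology.
Context {G : topologicalGroupType}.
Implicit Types (A K : set G).

Definition linear_open : set (set G) := [set A | forall a, A a ->
  exists K, [/\ open K, is_subgroup K & forall k, K k -> A (a * k)]].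

Let linear_openT : linear_open setT.
Proof. by move=> a _; exists setT; split=> //; exact: openT. Qed.

Lemma open_subgroupI K L : open K /\ is_subgroup K -> open L /\ is_subgroup L ->
  open (K `&` L) /\ is_subgroup (K `&` L).
Proof.
move=> [oK [K1 KM KV]] [oL [L1 LM LV]]; split; first exact: openI.
split=> [//|x y [Kx Lx] [Ky Ly]|x [Kx Lx]].
  by split; [exact: KM|exact: LM].
by split; [exact: KV|exact: LV].
Qed.

Let linear_openI : setI_closed linear_open.
Proof.
move=> A B oA oB a [/oA[K [oK sK KA]] /oB[L [oL sL LB]]].
have [oKL sKL] := open_subgroupI (conj oK sK) (conj oL sL).
by exists (K `&` L); split=> // k [/KA Aak /LB Bak].
Qed.

Let linear_open_bigcup (I : Type) (f : I -> set G) :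
  (forall i, linear_open (f i)) -> linear_open (\bigcup_i f i).
Proof.
move=> of_ a [i _ /of_[K [oK sK KA]]].
by exists K; split=> // k /KA; exists i.
Qed.

Definition linear_topology : topology G :=
  Topology linear_openT linear_openI linear_open_bigcup.

Lemma linear_open_open : linear_open `<=` open.
Proof.
move=> A lA; apply: open_nbhs_witness => x /lA[K [oK [K1 _ _] KA]].
apply/nbhs1P; apply: (@filterS _ (nbhs (1 : G)) _ K) => //.
exact: open_nbhs_nbhs.
Qed.

Lemma linear_open_coset K a : open K -> is_subgroup K ->
  linear_open [set x | K (a * x)].
Proof.
move=> oK sK x Kx; exists K; split=> // k Kk /=; rewrite mulgA.
by case: sK => _ + _; apply.
Qed.

Local Notation L := (retopologized linear_topology).

Lemma linear_nbhsP (a : L) (A : set L) : nbhs a A <->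
  exists K : set G, [/\ open K, is_subgroup K & forall k, K k -> A (a * k)].
Proof.
rewrite nbhsE; split.
  move=> [B [oB Ba] BA]; have [K [oK sK KB]] := (oB : linear_open B) a Ba.
  by exists K; split=> // k /KB /BA.
move=> [K [oK sK KA]]; exists [set x : L | K ((a : G)^-1 * x)].
  split; first exact: linear_open_coset.
  by rewrite /= [_ * _](mulVg (a : G)); case: sK.
by move=> x /= /KA; rewrite [_ * _](mulVKg (a : G)).
Qed.

(** The open subgroups are permuted by conjugation, which is what continuity of
multiplication needs. *)
Lemma linear_group_ops : continuous_group_ops L.
Proof.
split.
  move=> [a b] W /= /linear_nbhsP[K [oK sK KW]].
  exists ([set x : L | K (((a : G)^-1 * x) ^ (b : G))], [set y : L | K ((b : G)^-1 * y)]).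
    split=> /=; apply/linear_nbhsP.
      exists [set x : G | K (x ^ b)]; split.
      - by apply: open_comp oK => ? _; exact: conjg_continuous.
      - exact: conj_is_subgroup.
      - by move=> k Kk /=; rewrite [_ * _](mulKg (a : G)).
    by exists K; split=> // k Kk /=; rewrite [_ * _](mulKg (b : G)).
  move=> [x y] [/= Kx Ky].
  have /KW : K (((a : G)^-1 * x) ^ (b : G) * ((b : G)^-1 * y)).
    by case: sK => _ + _; apply.
  congr W; rewrite /=.
  change ((a : G) * b * (((a : G)^-1 * x) ^ (b : G) * ((b : G)^-1 * y)) = (x : G) * y).
  by rewrite !groupE.
move=> a W /= /linear_nbhsP[K [oK sK KW]]; apply/linear_nbhsP.
exists [set x : G | K (x ^ (a^-1 : G))]; split.
- by apply: open_comp oK => ? _; exact: conjg_continuous.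
- exact: conj_is_subgroup.
- move=> k Kk /=.
  have /KW : K (k ^ (a^-1 : G))^-1 by case: sK => _ _; apply.
  congr W; change ((a : G)^-1 * (k ^ (a : G)^-1)^-1 = ((a : G) * k)^-1).
  by rewrite !groupE.
Qed.

Hypothesis core1 : open_subgroup_core G `<=` [set 1].

Let core_separates (a b : G) : a <> b ->
  exists K, [/\ open K, is_subgroup K & ~ K (a^-1 * b)].
Proof.
move=> ab; apply: contrapT => nK; apply: ab.
have /core1 : open_subgroup_core G (a^-1 * b).
  by move=> K [oK sK]; apply: contrapT => nKab; apply: nK; exists K.
by move=> ab1; rewrite -(mulg1 a) -ab1 mulVKg.
Qed.

Let coset_disjoint K (a b x : G) : is_subgroup K ->
  K (a^-1 * x) -> K (b^-1 * x) -> K (a^-1 * b).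
Proof.
move=> [_ KM KV] Ka /KV Kb.
by have := KM _ _ Ka Kb; rewrite !groupE.
Qed.

Lemma linear_hausdorff : hausdorff_space L.
Proof.
move=> a b ab; apply: contrapT => /core_separates[K [oK sK]]; apply.
have aK : nbhs a [set x : L | K ((a : G)^-1 * x)].
  apply/linear_nbhsP; exists K; split=> // k Kk /=.
  by rewrite [_ * _](mulKg (a : G)).
have bK : nbhs b [set x : L | K ((b : G)^-1 * x)].
  apply/linear_nbhsP; exists K; split=> // k Kk /=.
  by rewrite [_ * _](mulKg (b : G)).
have [x [/= Kax Kbx]] := ab _ _ aK bK.
exact: coset_disjoint Kax Kbx.
Qed.

Lemma hausdorff_open_subgroup_core : hausdorff_space G.
Proof.
move=> a b ab; apply: contrapT => /core_separates[K [oK sK]]; apply.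
have K1 : nbhs 1 K by apply: open_nbhs_nbhs; split=> //; case: sK.
have [x [/= Kax Kbx]] := ab _ _ (nbhs_ltranslate a K1) (nbhs_ltranslate b K1).
exact: coset_disjoint Kax Kbx.
Qed.

(** By minimality the topology generated by the open subgroups is the given one,
and cosets of open subgroups are clopen. *)
Lemma minimal_zero_dimensional : minimal_group G -> zero_dimensional_space G.
Proof.
move=> [hG minG]; split.
  by split=> //; exact: topological_group_completely_regular.
have open_linear A : open A -> linear_open A.
  move=> oA; apply: contrapT => nlA; apply: minG; exists linear_topology.
  split; [exact: linear_group_ops|exact: linear_hausdorff|].
  by split; [exact: linear_open_open|move=> /(_ A oA)].
exists [set A : set G | exists a K, [/\ open K, is_subgroup K &
    A = [set x | K (a * x)]]].
  split.
    by move=> _ [a [K [oK sK ->]]]; exact: open_mulgl.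
  move=> x A; rewrite nbhsE => -[B [/open_linear lB /lB[K [oK sK KB]]] BA].
  exists [set y | K (x^-1 * y)].
    by split; [exists x^-1, K|rewrite /= mulVg; case: sK].
  by move=> y /KB; rewrite mulVKg => /BA.
move=> _ [a [K [oK sK ->]]]; apply: clopen_mulgl; exact: open_subgroup_clopen.
Qed.

End LinearTopology.

(** * Quotient maps *)

Section QuotientMap.
Local Open Scope quotient_scope.
Context {G : topologicalGroupType} (N : normal_subgroup G).

Definition quotient_map : G -> quotient_group N := \pi_(quotient_group N).

Let quotient_map_mul : {morph quotient_map : x y / x * y}.
Proof. by move=> x y; rewrite /quotient_map -pi_quotient_mul. Qed.

HB.instance Definition _ :=
  isMultiplicative.Build G (quotient_group N) quotient_map quotient_map_mul.

Lemma quotient_map_continuous : continuous quotient_map.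
Proof. exact: pi_continuous. Qed.

Lemma quotient_map_surj (y : quotient_group N) : exists x, quotient_map x = y.
Proof. by exists (repr y); exact: reprK. Qed.

Lemma quotient_map_eq1 x : quotient_map x = 1 <-> normal_set N x.
Proof.
have [N1 NM NV] := normal_is_subgroup N.
have -> : (1 : quotient_group N) = quotient_map 1 by [].
rewrite /quotient_map pi_quotient_groupP mulg1; split; last exact: NV.
by move=> /NV; rewrite invgK.
Qed.

(** The open subgroups of G all contain N, so they are the preimages of their
images in the quotient. *)
Lemma quotient_open_subgroup_core :
  normal_set N = open_subgroup_core G ->
  open_subgroup_core (quotient_group N) `<=` [set 1].
Proof.
move=> NE y cy; have [x xy] := quotient_map_surj y.
rewrite -xy; apply/quotient_map_eq1; rewrite NE => K [oK sK].
have NK z : normal_set N z -> K z by rewrite NE; apply.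
have [K1 KM KV] := sK.
have KE : quotient_map @^-1` (quotient_map @` K) = K.
  apply/seteqP; split=> z; last by exists z.
  move=> [k Kk /pi_quotient_groupP /NK Kkz].
  by rewrite -(mulVKg k z); exact: KM.
suff : (quotient_map @` K) (quotient_map x) by move=> ?; rewrite -KE.
rewrite xy; apply: cy; split.
  by change (open (quotient_map @^-1` (quotient_map @` K))); rewrite KE.
split.
- by exists 1.
- move=> _ _ [a Ka <-] [b Kb <-]; exists (a * b); [exact: KM|exact: gmulfM].
- move=> _ [a Ka <-]; exists a^-1; [exact: KV|by rewrite /quotient_map -pi_quotient_inv].
Qed.

End QuotientMap.

(** * Connected components and quasi-components *)

Section Components.
Context {G : topologicalGroupType}.

Lemma identity_component_sub_quasi : identity_component G `<=` quasi_component G.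
Proof.
move=> x G0x C [[oC cC] C1].
have cG0 : connected (identity_component G) by exact: component_connected.
have CE : identity_component G `&` C = identity_component G.
  apply: cG0; [|by exists C|by exists C].
  by exists 1; split=> //; exact: connected_component_refl.
by move: G0x; rewrite -CE => -[].
Qed.

(** A zero-dimensional group separates its points by clopen sets, and these pull
back to clopen sets. *)
Lemma quasi_component_sub_kernel :
  quasi_component G `<=` zero_dimensional_kernel G.
Proof.
move=> x qx H f [[hH _] [B [_ Bnbhs] Bclopen]] cf; apply: contrapT => /eqP fx1.
have [A [oA A1 nAx]] : exists A, [/\ open A, A 1 & ~ A (f x)].
  move: hH; rewrite open_hausdorff => /(_ _ _ fx1)[[A1 A2] /=].
  rewrite !inE => -[A1x A21] [_ oA2 A12]; exists A2; split=> // A2x.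
  by have : (A1 `&` A2) (f x) by []; rewrite A12.
have [C [BC C1] CA] := Bnbhs 1 A (open_nbhs_nbhs (conj oA A1)).
apply/nAx/CA; apply: (qx (f @^-1` C)); split; last first.
  have f1 : f 1 = 1 by apply: (mulgI (f 1)); rewrite -gmulfM !mulg1.
  by rewrite /= f1.
exact: preimage_clopen (Bclopen _ BC) cf.
Qed.

Lemma quasi_component_sub_core : quasi_component G `<=` open_subgroup_core G.
Proof.
move=> x qx K [oK sK]; apply: qx; split; first exact: open_subgroup_clopen.
by case: sK.
Qed.

Lemma zero_dimensional_kernel_quotient (N : normal_subgroup G) :
  zero_dimensional_space (quotient_group N) ->
  zero_dimensional_kernel G `<=` normal_set N.
Proof.
move=> zdQ x zx; apply/quotient_map_eq1.
exact: (zx _ (quotient_map N) zdQ (@quotient_map_continuous _ N)).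
Qed.

End Components.

Lemma locally_pseudocompact_quasi_component (R : realType)
    (G : topologicalGroupType) : locally_pseudocompact R G ->
  quasi_component G = open_subgroup_core G.
Proof.
move=> [U U1 pcU]; apply/seteqP; split; first exact: quasi_component_sub_core.
move=> x ox C [clC C1].
have fcU := pseudocompact_feebly_compact
  (@topological_group_completely_regular G) pcU.
have [K [oK sK KC]] := clopen_open_subgroup U1 fcU clC C1.
by apply: KC; apply: ox.
Qed.

Theorem theorem3 (R : realType) (G : topologicalGroupType)
    (hausG : hausdorff_space G)
    (minG : totally_minimal_group G)
    (lpcG : locally_pseudocompact R G) :
  (identity_component G = quasi_component G <->
     zero_dimensional_space (quotient_group (identity_component_normal G))) /\
  (identity_component G = quasi_component G -> strongly_vedenissoff G).
Proof.
have qE := locally_pseudocompact_quasi_component lpcG.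
have zdQ : identity_component G = quasi_component G ->
    zero_dimensional_space (quotient_group (identity_component_normal G)).
  rewrite qE => G0E.
  have core1 := @quotient_open_subgroup_core _ (identity_component_normal G) G0E.
  apply: minimal_zero_dimensional => //.
  exact/minG/hausdorff_open_subgroup_core.
split.
  split=> // zd; apply/seteqP; split; first exact: identity_component_sub_quasi.
  apply: subset_trans (zero_dimensional_kernel_quotient zd).
  exact: quasi_component_sub_kernel.
move=> G0E; split; first exact: zdQ.
apply/seteqP; split.
  rewrite -qE -G0E.
  exact: (zero_dimensional_kernel_quotient (zdQ G0E)).
by rewrite -qE; exact: quasi_component_sub_kernel.
Qed.
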